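(* The probability mass function $h_r^{(I)}(n)$ of the random variable $T_{r,k}^{(I)}$ satisfies the recursive scheme $$\begin{aligned}h_{r}^{(I)}(n)=&\,(\alpha+\beta)h_{r}^{(I)}(n-1)+(1-\alpha-\beta)h_{r}^{(I)}(n-2)-\alpha^{k-1}(1-\alpha)(1-\beta)h_{r}^{(I)}(n-k-1)\\&+\alpha^{k}h_{r-1}^{(I)}(n-k)-(1-\alpha-\alpha^{2}-\beta)\alpha^{k-1}h_{r-1}^{(I)}(n-k-1)\\&-(1-\alpha-\beta)\alpha^{k}h_{r-1}^{(I)}(n-k-2),\qquad r>1,\ n>k+2,\end{aligned}$$ with initial conditions $h_{0}^{(I)}(n)=\delta_{n,0}$ and $$h_{1}^{(I)}(n)=\begin{cases}0 & \text{if } 0\le n<k,\\ p\alpha^{k-1} & \text{if } n=k,\\ q\alpha^{k-1}(1-\beta) & \text{if } n=k+1,\\ \alpha^{k-1}(1-\beta)\{\beta q+p(1-\alpha)\} & \text{if } n=k+2.\end{cases}$$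
   Context: $(X_i)_{i\ge1}$ is an infinite sequence of two-state ($0$/$1$) Markov dependent Bernoulli trials with $P(X_i=1)=p$, $P(X_i=0)=1-p=q$, and, for $i>1$, $P(X_i=1\mid X_{i-1}=1)=\alpha$ and $P(X_i=0\mid X_{i-1}=0)=\beta$. $T_{r,k}^{(I)}$ is the waiting time until the $r$-th occurrence of a success run of length $k$ under the non-overlapping counting scheme (each time $k$ consecutive successes show up a run is counted and the counting starts anew from scratch), and $h_r^{(I)}(n)=P(T_{r,k}^{(I)}=n)$. $\delta_{n,0}$ is the Kronecker delta.
   Formalization: The term (1-α-α²-β)α^{k-1}h_{r-1}(n-k-1) is given sign + instead of − (printed sign fails for a fair coin, k=2, r=2, n=5), and the value of h_1 at n=k+2 is claimed only for k≥2, since for k=1 the printed value is false. *)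

(* Defs.v *)
From mathcomp Require Import all_boot all_order all_algebra.
From mathcomp Require Import all_classical all_reals all_analysis.

Set Implicit Arguments.
Unset Strict Implicit.
Unset Printing Implicit Defensive.

Import Order.TTheory GRing.Theory Num.Theory.

Local Open Scope classical_set_scope.
Local Open Scope ring_scope.

(* Trials are numbered from 1: [X i] is the i-th trial for [1 <= i], and
   [X 0] is never used.  [true] is a success (1), [false] a failure (0). *)

Section MarkovTrials.
Context (d : measure_display) (T : measurableType d) (R : realType).
Variables (P : probability T R) (X : nat -> {RV P >-> bool}).

Definition Pr (A : set T) : R := fine (P A).

(* Meaningful only when [Pr B != 0]; every use below is guarded. *)
Definition condPr (A B : set T) : R := Pr (A `&` B) / Pr B.

Definition trial_is (i : nat) (b : bool) : set T := [set w | X i w = b].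

Definition history (i : nat) (x : nat -> bool) : set T :=
  [set w | forall j, (1 <= j <= i)%N -> X j w = x j].

Definition markov_property : Prop :=
  forall (i : nat) (x : nat -> bool), (1 < i)%N -> Pr (history i.-1 x) != 0 ->
    condPr (trial_is i (x i)) (history i.-1 x) =
    condPr (trial_is i (x i)) (trial_is i.-1 (x i.-1)).

Definition markov_bernoulli (p alpha beta : R) : Prop :=
  [/\ markov_property,
      Pr (trial_is 1 true) = p,
      Pr (trial_is 1 false) = 1 - p,
      forall i, (1 < i)%N -> Pr (trial_is i.-1 true) != 0 ->
        condPr (trial_is i true) (trial_is i.-1 true) = alpha &
      forall i, (1 < i)%N -> Pr (trial_is i.-1 false) != 0 ->
        condPr (trial_is i false) (trial_is i.-1 false) = beta].

(* State: (number of runs counted so far, successes accumulated towards the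
   next run).  On completing [k] consecutive successes the accumulated number
   restarts from 0, so counted runs do not overlap. *)
Definition run_step (k : nat) (st : nat * nat) (b : bool) : nat * nat :=
  if b then if st.2.+1 == k then (st.1.+1, 0%N) else (st.1, st.2.+1)
  else (st.1, 0%N).

Definition runs_count (k : nat) (s : seq bool) : nat :=
  (foldl (run_step k) (0%N, 0%N) s).1.

Definition trials (n : nat) (w : T) : seq bool := [seq X i w | i <- iota 1 n].

(* [None] stands for an infinite waiting time. *)
Definition waiting_time (r k : nat) (w : T) : option nat :=
  if pselect (exists n, (r <= runs_count k (trials n w))%N) is left e
  then Some (ex_minn e) else None.

Definition waiting_pmf (k r n : nat) : R :=
  Pr [set w | waiting_time r k w = Some n].

End MarkovTrials.

(* Main.v *)
(** Let [f c n] and [S c n] be the probabilities that [c] runs have been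
    counted after [n] trials and that trial [n] is a failure, resp. a success,
    and let [g c n] be the probability that the [c]-th run is completed at
    trial [n], i.e. [h c n] when [c > 0].  Writing down how probability flows
    between counts gives
      f c (n+1) = beta f c n + (1 - alpha) S c n,
      S c (n+1) = (1 - beta) f c n + alpha S c n + g c (n+1) - g (c+1) (n+1),
    hence, eliminating [S], a second-order recursion for [f c] with source term
    [(1 - alpha) (g c - g (c+1))].  A run completed at trial [n+k] consists of
    [k] successes started from zero progress at trial [n], so
      g (c+1) (n+k) = alpha^(k-1) ((1 - beta) f c n + alpha g c n),
    and substituting the recursion for [f c] yields the one for [g (c+1)]. *)

Require Import Defs.
From mathcomp Require Import all_boot all_order all_algebra.
From mathcomp Require Import all_classical all_reals all_analysis.
From mathcomp Require Import zify ring.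

Set Implicit Arguments.
Unset Strict Implicit.
Unset Printing Implicit Defensive.

Import Order.TTheory GRing.Theory Num.Theory.
Local Open Scope ring_scope.

(** * The deterministic run counter on finite words *)

Section RunCounter.
Variable k : nat.

(** Zero progress after a success can only come from progress [k - 1], so a success can be undone;
    this is what lets events be pulled back one trial. *)
Lemma run_step_true_inj : injective (fun st => run_step k st true).
Proof.
move=> [c j] [c' j'] /=; rewrite /run_step /=.
by case: eqP => ej; case: eqP => ej' [] *; congr pair; lia.
Qed.

Definition run_state (s : seq bool) := foldl (run_step k) (0%N, 0%N) s.

Lemma run_state_rcons s b :
  run_state (rcons s b) = run_step k (run_state s) b.
Proof. by rewrite /run_state foldl_rcons. Qed.

Lemma run_state_rcons_false s :
  run_state (rcons s false) = ((run_state s).1, 0%N).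
Proof. by rewrite run_state_rcons. Qed.

Lemma run_state_size s :
  ((run_state s).1 * k + (run_state s).2 <= size s)%N.
Proof.
elim/last_ind: s => [//|s b IH]; rewrite size_rcons run_state_rcons.
case: (run_state s) IH => c j /=; rewrite /run_step /=.
by case: b => /=; first case: eqP => /= *; nia.
Qed.

Lemma runs_count_rcons s b :
  (runs_count k s <= runs_count k (rcons s b) <= (runs_count k s).+1)%N.
Proof.
rewrite /runs_count -!/(run_state _) run_state_rcons /run_step.
by case: b => //=; [case: ifP => _ /=|]; lia.
Qed.

(** The count rises only at a success that brings the progress back to zero. The factor [b] matters:
    a failure also resets the progress, without completing a run. *)
Lemma run_completed s b c :
  (b && (run_state (rcons s b) == (c.+1, 0%N)))
  = (runs_count k s == c) && (runs_count k (rcons s b) == c.+1).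
Proof.
rewrite /runs_count -!/(run_state _) run_state_rcons /run_step.
case: (run_state s) b => c' j [] /=; last by lia.
case: ifP => _ /=; rewrite xpair_eqE; last by lia.
by rewrite eqxx andbT; lia.
Qed.

End RunCounter.

(** * Real-valued probabilities of events given by boolean predicates *)

Section Events.
Context (d : measure_display) (T : measurableType d) (R : realType).
Variables (P : probability T R).

Lemma Pr_set0 : Pr P set0 = 0.
Proof. by rewrite /Pr measure0. Qed.

Lemma Pr_setT : Pr P setT = 1.
Proof. by rewrite /Pr probability_setT. Qed.

Lemma Pr_ge0 A : 0 <= Pr P A.
Proof. by rewrite /Pr fine_ge0. Qed.

Lemma Pr_le A B : measurable A -> measurable B -> (A `<=` B)%classic ->
  Pr P A <= Pr P B.
Proof.
move=> mA mB AB; apply: fine_le; rewrite ?fin_num_measure//.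
by apply: le_measure; rewrite ?inE.
Qed.

Lemma Pr_eq0S A B : measurable A -> measurable B -> (A `<=` B)%classic ->
  Pr P B = 0 -> Pr P A = 0.
Proof.
move=> mA mB AB B0; apply/eqP; rewrite eq_le Pr_ge0 andbT -B0.
exact: Pr_le.
Qed.

Lemma Pr_setU A B : measurable A -> measurable B ->
  (A `&` B = set0)%classic -> Pr P (A `|` B)%classic = Pr P A + Pr P B.
Proof.
move=> mA mB AB; rewrite /Pr measureU//.
by rewrite fineD// fin_num_measure.
Qed.

Lemma PrID A B : measurable A -> measurable B ->
  Pr P A = Pr P (A `&` B)%classic + Pr P (A `&` ~` B)%classic.
Proof.
move=> mA mB; rewrite -Pr_setU.
- by rewrite -setIUr setUv setIT.
- exact: measurableI.
- by apply: measurableI => //; exact: measurableC.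
- by rewrite setIACA setICr setI0.
Qed.

Definition event (phi : T -> bool) := measurable [set w | phi w]%classic.
Definition prob (phi : T -> bool) : R := Pr P [set w | phi w]%classic.

Lemma eq_prob phi psi : phi =1 psi -> prob phi = prob psi.
Proof. by move=> e; congr Pr; apply/seteqP; split=> w /=; rewrite e. Qed.

Lemma prob0 phi : phi =1 xpred0 -> prob phi = 0.
Proof.
move=> e; rewrite -Pr_set0; congr Pr; apply/seteqP.
by split=> w //=; rewrite e.
Qed.

Lemma eq_event phi psi : phi =1 psi -> event phi -> event psi.
Proof.
by move=> e; rewrite /event; have -> : phi = psi by apply/funext.
Qed.

Lemma eventI phi psi : event phi -> event psi ->
  event (fun w => phi w && psi w).
Proof.
move=> mphi mpsi; rewrite /event.
rewrite (_ : [set _ | _]%classic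
           = ([set w | phi w] `&` [set w | psi w])%classic).
  exact: measurableI.
by apply/seteqP; split=> w /= /andP.
Qed.

Lemma eventC phi : event phi -> event (fun w => ~~ phi w).
Proof.
move=> mphi; rewrite /event.
rewrite (_ : [set _ | _]%classic = (~` [set w | phi w])%classic).
  exact: measurableC.
by apply/seteqP; split=> w /= /negP.
Qed.

Lemma eventU phi psi : event phi -> event psi ->
  event (fun w => phi w || psi w).
Proof.
move=> mphi mpsi.
apply: (@eq_event (fun w => ~~ (~~ phi w && ~~ psi w))).
  by move=> w; rewrite negb_and !negbK.
by apply/eventC/eventI; exact: eventC.
Qed.

Lemma probID psi phi : event phi -> event psi ->
  prob phi = prob (fun w => phi w && psi w) + prob (fun w => phi w && ~~ psi w).
Proof.
move=> mphi mpsi; rewrite /prob (PrID mphi mpsi); congr (_ + _); congr Pr.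
  by apply/seteqP; split=> w /= /andP.
apply/seteqP; split=> w /=; first by case=> -> /negP.
by case/andP => ? /negP.
Qed.

End Events.
Arguments event {d T} phi.

(** * Measurability of trial events, and the waiting time as a run completion *)

Section Trials.
Context (d : measure_display) (T : measurableType d) (R : realType).
Context (P : probability T R) (X : nat -> {RV P >-> bool}).

Lemma trials_rcons n w : trials X n.+1 w = rcons (trials X n w) (X n.+1 w).
Proof.
by rewrite /trials -[in iota 1 _](addn1 n) iotaD map_cat cats1 add1n.
Qed.

Lemma size_trials n w : size (trials X n w) = n.
Proof. by rewrite size_map size_iota. Qed.

Lemma last_trials n w b : (0 < n)%N -> last b (trials X n w) = X n w.
Proof. by case: n => // n _; rewrite trials_rcons last_rcons. Qed.

Lemma eventX n : event (X n).
Proof.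
rewrite /event -[X in measurable X]setTI.
by apply: (@measurable_funPT _ _ _ _ (X n) measurableT [set true]%classic).
Qed.

Lemma event_eqX n b : event (fun w => X n w == b).
Proof.
case: b; last by apply: eq_event (eventC (eventX n)) => w; case: (X n w).
by apply: eq_event (eventX n) => w; case: (X n w).
Qed.

Lemma event_trials n (B : pred (seq bool)) : event (fun w => B (trials X n w)).
Proof.
elim: n B => [|n IH] B.
  rewrite /event /trials /=; case: (B [::]).
    rewrite (_ : [set _ | _]%classic = setT)//; exact/seteqP.
  by rewrite (_ : [set _ | _]%classic = set0)//; apply/seteqP; split.
apply: (@eq_event _ _ (fun w => (B (rcons (trials X n w) true) && X n.+1 w)
  || (B (rcons (trials X n w) false) && ~~ X n.+1 w))).
  move=> w; rewrite trials_rcons.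
  by case: (X n.+1 w); rewrite ?andbT ?andbF ?orbF.
apply: eventU; apply: eventI.
- exact: (IH (fun s => B (rcons s true))).
- exact: eventX.
- exact: (IH (fun s => B (rcons s false))).
- exact: eventC (eventX _).
Qed.

Lemma probX n phi : event phi ->
  prob P phi = prob P (fun w => phi w && (X n w == false))
             + prob P (fun w => phi w && (X n w == true)).
Proof.
move=> mphi; rewrite (probID P mphi (eventX n)) addrC; congr (_ + _).
  by apply: eq_prob => w; case: (X n w).
by apply: eq_prob => w; case: (X n w).
Qed.

Lemma waiting_time_some r k w n : waiting_time X r k w = Some n <->
  (r <= runs_count k (trials X n w))%N /\
  (forall m, (r <= runs_count k (trials X m w))%N -> (n <= m)%N).
Proof.
rewrite /waiting_time; case: pselect => [e|ne]; last first.
  by split=> // -[hn _]; case: ne; exists n.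
case: ex_minnP => m hm m_min; split=> [[<-]//|[hn n_min]].
by congr Some; apply/eqP; rewrite eqn_leq m_min// n_min.
Qed.

Lemma runs_count_mono k w m n : (m <= n)%N ->
  (runs_count k (trials X m w) <= runs_count k (trials X n w))%N.
Proof.
move=> /subnK <-; elim: (n - m)%N => // i IH.
apply: leq_trans IH _; rewrite addSn trials_rcons.
by case/andP: (runs_count_rcons k (trials X (i + m) w) (X (i + m).+1 w)).
Qed.

(** The count is monotone and grows by at most one per trial, so it first reaches [c.+1] exactly at
    the trial where it jumps from [c] to [c.+1]. *)
Lemma waiting_time_completed c k w n :
  waiting_time X c.+1 k w = Some n <->
  (0 < n)%N && X n w && (run_state k (trials X n w) == (c.+1, 0%N)).
Proof.
apply: (iff_trans (waiting_time_some _ _ _ _)).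
case: n => [|n]; first by split=> // -[].
rewrite /= trials_rcons run_completed -trials_rcons.
have := runs_count_rcons k (trials X n w) (X n.+1 w).
rewrite -trials_rcons => step; split.
  move=> [hr /(_ n)]; rewrite ltnn; case: ltnP => [_ /(_ isT)//|hn _].
  by lia.
move=> /andP[/eqP hc /eqP ->]; split=> // m; apply: contraTT.
by rewrite -ltnNge ltnS => /(runs_count_mono k w); rewrite hc; lia.
Qed.

(** In the notation of the overview, [count_pr k n c false] is [f c n], [count_pr k n c true] is
    [S c n], and [state_pr k n (c, 0) true] is [g c n]. *)
Definition state_pr k n x b : R :=
  prob P (fun w => (run_state k (trials X n w) == x) && (X n w == b)).
Definition count_pr k n c b : R :=
  prob P (fun w => (runs_count k (trials X n w) == c) && (X n w == b)).

Lemma waiting_pmf_state k c n :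
  waiting_pmf X k c.+1 n.+1 = state_pr k n.+1 (c.+1, 0%N) true.
Proof.
rewrite /waiting_pmf /state_pr /prob; congr Pr; apply/seteqP.
split=> w /=; first by move/waiting_time_completed; rewrite eqb_id andbC.
by move=> h; apply/waiting_time_completed; rewrite andbC -[X _ _]eqb_id.
Qed.

Lemma waiting_pmf_lt k c n : (n < c.+1 * k)%N -> waiting_pmf X k c.+1 n = 0.
Proof.
move=> nk; rewrite -(Pr_set0 P); congr Pr; apply/seteqP; split=> // w /=.
move=> /waiting_time_completed /andP[_ /eqP e].
have := run_state_size k (trials X n w); rewrite e size_trials /=.
by rewrite addn0 leqNgt nk.
Qed.

Lemma waiting_pmf0 k n : waiting_pmf X k 0 n = (n == 0)%N%:R.
Proof.
case: n => [|n] /=.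
  rewrite -(Pr_setT P); congr Pr; apply/seteqP; split=> // w _ /=.
  exact/waiting_time_some.
rewrite mulr0n -(Pr_set0 P); congr Pr; apply/seteqP; split=> // w /=.
by case/waiting_time_some => _ /(_ 0%N (leq0n _)).
Qed.

End Trials.

(** * One-step transitions conditioned on an arbitrary event of the past *)

Section MarkovBernoulli.
Context (d : measure_display) (T : measurableType d) (R : realType).
Context (P : probability T R) (X : nat -> {RV P >-> bool}).
Variables (p alpha beta : R).
Hypothesis hX : markov_bernoulli X p alpha beta.

Definition transition (b b' : bool) : R :=
  if b then if b' then alpha else 1 - alpha
  else if b' then 1 - beta else beta.

Lemma trial_isE n b : trial_is X n b = [set w | X n w == b]%classic.
Proof. by apply/seteqP; split=> w /= => [->|/eqP]. Qed.

(** Staying in the same state is given by [alpha] or [beta]; switching follows by taking the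
    complement. *)
Lemma condPr_transition n b b' : (0 < n)%N -> Pr P (trial_is X n b) != 0 ->
  condPr P (trial_is X n.+1 b') (trial_is X n b) = transition b b'.
Proof.
case: hX => _ _ _ h1 h0 n0 nz.
have hbb : condPr P (trial_is X n.+1 b) (trial_is X n b) = transition b b.
  by case: b nz => nz; [exact: (h1 n.+1)|exact: (h0 n.+1)].
have [<-//|nbb'] := eqVneq b b'.
have {nbb'}-> : b' = ~~ b by case: b b' nbb' {nz hbb} => [] [].
have mt m c : measurable (trial_is X m c).
  by rewrite trial_isE; exact: (event_eqX X m c).
have -> : trial_is X n.+1 (~~ b) = (~` trial_is X n.+1 b)%classic.
  rewrite /trial_is; apply/seteqP; split=> w /= => [->|/eqP].
    by case: (b).
  by case: (X n.+1 w); case: (b).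
have := PrID P (mt n b) (mt n.+1 b).
rewrite /condPr in hbb *; rewrite ![(trial_is X n b `&` _)%classic]setIC => e.
have -> : transition b (~~ b) = 1 - transition b b.
  by rewrite /transition; case: (b) => /=; ring.
by rewrite -hbb -[X in X - _](divff nz) -mulrBl [X in (X - _) / _]e addrC addKr.
Qed.

Lemma prob_trials_eq n s b' : (0 < n)%N -> size s = n ->
  prob P (fun w => (trials X n w == s) && (X n.+1 w == b'))
  = transition (last false s) b' * prob P (fun w => trials X n w == s).
Proof.
(* The path spelling [s] and then [b']; the index shifts by one since trials are numbered from 1. *)
move=> n0 sz; pose x j := nth false (rcons s b') j.-1.
have xn : x n = last false s.
  by rewrite /x nth_rcons sz prednK// leqnn -sz nth_last.
have xn1 : x n.+1 = b' by rewrite /x /= nth_rcons sz ltnn eqxx.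
have hE : history X n x = [set w | trials X n w == s]%classic.
  apply/seteqP; split=> w /= h.
    apply/eqP; apply: (@eq_from_nth _ false); rewrite size_trials// => i ni.
    rewrite (nth_map 0%N) ?size_iota// nth_iota// h ?add1n// /x /=.
    by rewrite nth_rcons sz ni.
  move=> j /andP[j0 jn]; rewrite /x -(eqP h) nth_rcons size_trials.
  have jn' : (j.-1 < n)%N by lia.
  by rewrite jn' (nth_map 0%N) ?size_iota// nth_iota// add1n prednK.
have ms := event_trials X n (pred1 s).
have mI := eventI ms (event_eqX X n.+1 b').
have ml := event_eqX X n (last false s).
rewrite /prob.
(* The Markov property says nothing about a past of probability zero, but there both sides
   vanish. *)
have [z|nz] := eqVneq (Pr P [set w | trials X n w == s]%classic) 0.
  rewrite z mulr0; apply: Pr_eq0S mI ms _ z => w /=.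
  by case/andP.
have nzl : Pr P (trial_is X n (last false s)) != 0.
  apply: contra nz => /eqP z; apply/eqP; rewrite trial_isE in z.
  apply: Pr_eq0S ms ml _ z => w /= /eqP <-.
  by rewrite last_trials.
case: hX => mk _ _ _ _.
have := mk n.+1 x n0; rewrite /= hE xn xn1 => /(_ nz).
rewrite condPr_transition// /condPr => <-; rewrite divfK//.
congr Pr; rewrite trial_isE; apply/seteqP; split=> w /=.
  by case/andP.
by case=> -> ->.
Qed.

(** The event is a finite disjoint union of words of length [n] ending in [b]; each contributes the
    same factor, so the factor comes out of the sum. *)
Lemma prob_transition n (B : pred (seq bool)) b b' : (0 < n)%N ->
  prob P (fun w => B (trials X n w) && (X n w == b) && (X n.+1 w == b'))
  = transition b b' * prob P (fun w => B (trials X n w) && (X n w == b)).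
Proof.
move=> n0.
pose C (s : seq bool) := B s && (last false s == b).
have Cl l : uniq l -> all (fun s => (size s == n) && C s) l ->
    prob P (fun w => (trials X n w \in l) && (X n.+1 w == b'))
  = transition b b' * prob P (fun w => trials X n w \in l).
  elim: l => [|s l IH] /=; first by rewrite !prob0 ?mulr0.
  move=> /andP[sl ul] /andP[/andP[/eqP sz /andP[_ /eqP sb]] al].
  have ms := event_trials X n (pred1 s).
  have ml := event_trials X n (mem (s :: l)).
  have split_head phi : event phi ->
     prob P (fun w => (trials X n w \in s :: l) && phi w)
     = prob P (fun w => (trials X n w == s) && phi w)
     + prob P (fun w => (trials X n w \in l) && phi w).
    move=> mphi; rewrite (probID P (eventI ml mphi) ms).
    congr (_ + _); apply: eq_prob => w /=; rewrite inE.
      by case: eqP => //=; rewrite ?andbF ?andbT.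
    by case: eqP => [->|_] /=; rewrite ?andbF ?andbT// (negbTE sl).
  rewrite split_head; last exact: event_eqX.
  (* The trivial event gives the same splitting for the right-hand side, where trial [n.+1] does not
     occur. *)
  have := split_head xpredT.
  under eq_prob do rewrite andbT.
  under [X in _ = X + _]eq_prob do rewrite andbT.
  under [X in _ = _ + X]eq_prob do rewrite andbT.
  move=> ->; last exact: (event_trials X n xpredT).
  by rewrite prob_trials_eq// IH// sb mulrDr.
pose l := [seq s <- [seq val t | t <- enum {: n.-tuple bool}] | C s].
have inl w : (trials X n w \in l) = B (trials X n w) && (X n w == b).
  rewrite mem_filter {1}/C last_trials// -[RHS]andbT; congr andb.
  have sz : size (trials X n w) == n by rewrite size_trials.
  by apply/mapP; exists (Tuple sz); rewrite ?mem_enum.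
under eq_prob do rewrite -inl.
under [X in _ * X]eq_prob do rewrite -inl.
apply: Cl.
  by rewrite filter_uniq// map_inj_uniq ?enum_uniq//; exact: val_inj.
apply/allP => s; rewrite mem_filter => /andP[-> /mapP[t _ ->]].
by rewrite size_tuple eqxx.
Qed.

Lemma prob_next n (B : pred (seq bool)) b' : (0 < n)%N ->
  prob P (fun w => B (trials X n w) && (X n.+1 w == b'))
  = transition false b' * prob P (fun w => B (trials X n w) && (X n w == false))
  + transition true b' * prob P (fun w => B (trials X n w) && (X n w == true)).
Proof.
move=> n0; rewrite -!prob_transition// (probX X n).
  by congr (_ + _); apply: eq_prob => w; rewrite andbAC.
by apply: eventI; [exact: event_trials|exact: event_eqX].
Qed.

(** * Probability flow between counter states, and the recursion *)

Variable k : nat.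
Hypothesis k_gt0 : (0 < k)%N.

Lemma state_pr_true n x :
  state_pr X k n.+1 (run_step k x true) true
  = prob P (fun w => (run_state k (trials X n w) == x) && (X n.+1 w == true)).
Proof.
apply: eq_prob => w; rewrite trials_rcons run_state_rcons.
case: (X n.+1 w); last by rewrite !andbF.
by rewrite (inj_eq (@run_step_true_inj k)).
Qed.

Lemma state_pr_next n x : (0 < n)%N ->
  state_pr X k n.+1 (run_step k x true) true
  = (1 - beta) * state_pr X k n x false + alpha * state_pr X k n x true.
Proof.
by move=> n0; rewrite state_pr_true (prob_next (fun s => run_state k s == x)).
Qed.

Lemma state_pr_false_gt0 n c j : (0 < n)%N ->
  state_pr X k n (c, j.+1) false = 0.
Proof.
case: n => // n _; apply: prob0 => w.
rewrite trials_rcons; case: (X n.+1 w); rewrite ?andbF//.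
by rewrite run_state_rcons_false xpair_eqE andbF.
Qed.

(** A success leaves either positive progress or a positive count, so [g 0] vanishes after trial
    0. *)
Lemma state_pr0_true n : state_pr X k n.+1 (0%N, 0%N) true = 0.
Proof.
apply: prob0 => w.
rewrite trials_rcons run_state_rcons; case: (X n.+1 w); rewrite ?andbF//.
by rewrite /run_step; case: ifP; rewrite xpair_eqE /= ?andbF.
Qed.

(** Positive progress rules out a failure at the last trial, so each success after the first is
    reached from a success and costs a factor [alpha]. *)
Lemma state_pr_run n c j : (j < k)%N ->
  state_pr X k (n + j).+1 (run_step k (c, j) true) true
  = alpha ^+ j * state_pr X k n.+1 (run_step k (c, 0%N) true) true.
Proof.
elim: j => [|j IH] jk; first by rewrite addn0 mul1r.
rewrite addnS state_pr_next// state_pr_false_gt0// mulr0 add0r exprS -mulrA.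
rewrite -IH 1?ltnW//; congr (_ * state_pr _ _ _ _ _).
by rewrite /run_step /= ltn_eqF.
Qed.

Lemma state_pr_completed n c :
  state_pr X k (n + k) (c.+1, 0%N) true
  = alpha ^+ k.-1 * state_pr X k n.+1 (run_step k (c, 0%N) true) true.
Proof.
rewrite -state_pr_run ?prednK// -addnS prednK//.
by rewrite /run_step /= prednK ?eqxx.
Qed.

Lemma count_pr_false n c :
  count_pr X k n.+1 c false = state_pr X k n.+1 (c, 0%N) false.
Proof.
apply: eq_prob => w; rewrite trials_rcons.
case: (X n.+1 w); rewrite ?andbF//.
rewrite /runs_count -/(run_state _ _) run_state_rcons_false /=.
by rewrite xpair_eqE eqxx !andbT.
Qed.

Lemma count_pr_next_false n c : (0 < n)%N ->
  count_pr X k n.+1 c false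
  = beta * count_pr X k n c false + (1 - alpha) * count_pr X k n c true.
Proof.
move=> n0; rewrite -(prob_next (fun s => runs_count k s == c) false)//.
apply: eq_prob => w; rewrite trials_rcons.
case: (X n.+1 w); rewrite ?andbF//.
by rewrite /runs_count -!/(run_state _ _) run_state_rcons.
Qed.

(* Balance at a success: the paths with count [c] before trial [n.+1] are those
   with count [c] after it, except that a run completed at that trial moves a
   path from count [c] to [c.+1], or brings it in from count [c.-1]. *)
Lemma count_pr_next_true n c : (0 < n)%N ->
  count_pr X k n.+1 c true + state_pr X k n.+1 (c.+1, 0%N) true
  = (1 - beta) * count_pr X k n c false + alpha * count_pr X k n c true
    + state_pr X k n.+1 (c, 0%N) true.
Proof.
move=> n0; rewrite -(prob_next (fun s => runs_count k s == c) true)//.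
have m1 : event (fun w =>
    (runs_count k (trials X n.+1 w) == c) && (X n.+1 w == true)).
  apply: eventI; last exact: event_eqX.
  exact: (event_trials X n.+1 (fun s => runs_count k s == c)).
have m2 : event (fun w =>
    (runs_count k (trials X n w) == c) && (X n.+1 w == true)).
  apply: eventI; last exact: event_eqX.
  exact: (event_trials X n (fun s => runs_count k s == c)).
(* Both events are split by whether progress is zero after trial [n.+1]: the zero parts are the
   completed runs, the other parts coincide. *)
have m3 := event_trials X n.+1 (fun s => (run_state k s).2 == 0%N).
rewrite /count_pr (probID P m1 m3) (probID P m2 m3).
rewrite -addrA [RHS]addrC; congr (_ + _).
  apply: eq_prob => w; rewrite -andbA [_ && (_ == 0%N)]andbC andbA.
  by rewrite -xpair_eqE -surjective_pairing.
rewrite addrC; congr (_ + _); apply: eq_prob => w;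
  rewrite trials_rcons /runs_count -!/(run_state _ _) run_state_rcons /run_step;
  case: (X n.+1 w); rewrite ?andbF// !andbT;
  case: (run_state k _) => c' j' /=; case: ifP => _ /=;
  by rewrite ?andbF ?andbT ?xpair_eqE ?andbF ?andbT.
Qed.

Lemma count_pr_rec n c : (0 < n)%N ->
  count_pr X k n.+2 c false
  = (alpha + beta) * count_pr X k n.+1 c false
    + (1 - alpha - beta) * count_pr X k n c false
    + (1 - alpha) * (state_pr X k n.+1 (c, 0%N) true
                     - state_pr X k n.+1 (c.+1, 0%N) true).
Proof.
move=> n0; have e1 := count_pr_next_true c n0.
rewrite (count_pr_next_false c (ltn0Sn n))//.
have -> : count_pr X k n.+1 c true =
  (1 - beta) * count_pr X k n c false + alpha * count_pr X k n c true
    + state_pr X k n.+1 (c, 0%N) true - state_pr X k n.+1 (c.+1, 0%N) true.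
  by rewrite -e1 addrK.
by rewrite (count_pr_next_false c n0)//; ring.
Qed.

Lemma waiting_pmf_count n c : (0 < n)%N ->
  waiting_pmf X k c.+1 (n + k) = alpha ^+ k.-1 *
  ((1 - beta) * count_pr X k n c false + alpha * state_pr X k n (c, 0%N) true).
Proof.
case: n => // n _; rewrite addSn waiting_pmf_state -addSn.
by rewrite state_pr_completed state_pr_next// count_pr_false.
Qed.

(** Replacing [(1 - beta) f] by [h] at the two earlier times leaves corrections in [alpha ^+ k * g].
    At [m.+2] the correction joins the source term: [(1 - alpha) (1 - beta) - alpha (alpha + beta) =
    1 - alpha - alpha ^+ 2 - beta], entering with a plus sign. *)
Lemma waiting_pmf_rec m c :
  waiting_pmf X k c.+2 (m.+3 + k)
  = (alpha + beta) * waiting_pmf X k c.+2 (m.+2 + k)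
    + (1 - alpha - beta) * waiting_pmf X k c.+2 (m.+1 + k)
    - alpha ^+ k.-1 * (1 - alpha) * (1 - beta) * waiting_pmf X k c.+2 m.+2
    + alpha ^+ k * waiting_pmf X k c.+1 m.+3
    + (1 - alpha - alpha ^+ 2 - beta) * alpha ^+ k.-1
      * waiting_pmf X k c.+1 m.+2
    - (1 - alpha - beta) * alpha ^+ k * waiting_pmf X k c.+1 m.+1.
Proof.
rewrite !waiting_pmf_count// (@count_pr_rec m.+1)// -!waiting_pmf_state.
by rewrite -[in alpha ^+ k](prednK k_gt0) exprS; ring.
Qed.

(** * Initial values for the first run *)

Lemma waiting_pmf1_k : waiting_pmf X k 1 k = p * alpha ^+ k.-1.
Proof.
have [_ hp _ _ _] := hX.
(* The run starts before any trial, so its first success has the initial probability [p] instead of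
   a transition probability. *)
have -> : waiting_pmf X k 1 k = state_pr X k (0 + k) (1%N, 0%N) true.
  rewrite add0n -[in LHS](prednK k_gt0) -[in RHS](prednK k_gt0).
  exact: waiting_pmf_state.
rewrite state_pr_completed mulrC; congr (_ * _).
rewrite state_pr_true -hp trial_isE.
by congr Pr.
Qed.

Lemma count_pr1_false : count_pr X k 1 0 false = 1 - p.
Proof.
have [_ _ hq _ _] := hX; rewrite -hq trial_isE; congr Pr.
apply/seteqP; split=> w /=; first by case/andP.
by rewrite /trials /= => /eqP ->.
Qed.

(** When [k = 1] a success at trial 1 already completes a run and the count is no longer 0; hence
    the bound on [k] here and in the value at [k.+2]. *)
Lemma count_pr1_true : (1 < k)%N -> count_pr X k 1 0 true = p.
Proof.
move=> k1; have [_ hp _ _ _] := hX; rewrite -hp trial_isE; congr Pr.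
apply/seteqP; split=> w /=; first by case/andP.
rewrite /trials /= => /eqP ->; rewrite /runs_count /= /run_step /=.
by rewrite (ltn_eqF k1).
Qed.

Lemma waiting_pmf1_k1 :
  waiting_pmf X k 1 k.+1 = (1 - p) * alpha ^+ k.-1 * (1 - beta).
Proof.
rewrite -(add1n k) waiting_pmf_count// count_pr1_false state_pr0_true; ring.
Qed.

Lemma waiting_pmf1_k2 : (1 < k)%N -> waiting_pmf X k 1 k.+2
  = alpha ^+ k.-1 * (1 - beta) * (beta * (1 - p) + p * (1 - alpha)).
Proof.
move=> k1; rewrite -(add2n k) waiting_pmf_count// state_pr0_true.
rewrite count_pr_next_false// count_pr1_false count_pr1_true//; ring.
Qed.

End MarkovBernoulli.

Theorem theorem3p10 (d : measure_display) (T : measurableType d) (R : realType)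
    (P : probability T R) (X : nat -> {RV P >-> bool})
    (p q alpha beta : R) (k : nat)
    (hk : (1 <= k)%N) (hq : q = 1 - p)
    (hX : markov_bernoulli X p alpha beta) :
  let h := waiting_pmf X k in
  [/\ forall r n : nat, (1 < r)%N -> (k + 2 < n)%N ->
        h r n = (alpha + beta) * h r (n - 1)%N
                + (1 - alpha - beta) * h r (n - 2)%N
                - alpha ^+ (k - 1) * (1 - alpha) * (1 - beta)
                  * h r (n - k - 1)%N
                + alpha ^+ k * h (r - 1)%N (n - k)%N
                + (1 - alpha - alpha ^+ 2 - beta) * alpha ^+ (k - 1)
                  * h (r - 1)%N (n - k - 1)%N
                - (1 - alpha - beta) * alpha ^+ k
                  * h (r - 1)%N (n - k - 2)%N,
      forall n : nat, h 0%N n = (n == 0%N)%:R &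
      [/\ forall n : nat, (n < k)%N -> h 1%N n = 0,
          h 1%N k = p * alpha ^+ (k - 1),
          h 1%N (k + 1)%N = q * alpha ^+ (k - 1) * (1 - beta) &
          (2 <= k)%N -> h 1%N (k + 2)%N =
            alpha ^+ (k - 1) * (1 - beta)
            * (beta * q + p * (1 - alpha))]].
Proof.
move=> h; split.
- case=> [//|[//|c]] n _ nk.
  (* The bound [k + 2 < n] keeps every time at which the recursion for [f] is used positive. *)
  have [m ->] : exists m, n = (m.+3 + k)%N by exists (n - k - 3)%N; lia.
  rewrite /h (waiting_pmf_rec hX hk m c) !subn1 /= addnK.
  have -> : (m.+3 + k - 2)%N = (m.+1 + k)%N by lia.
  by rewrite addSn /= subn2.
- exact: waiting_pmf0.
split.
- by move=> n nk; apply: waiting_pmf_lt; rewrite mul1n.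
- by rewrite subn1; apply: (waiting_pmf1_k hX).
- by rewrite addn1 subn1 hq; apply: (waiting_pmf1_k1 hX).
- by rewrite addn2 subn1 hq; apply: (waiting_pmf1_k2 hX).
Qed.
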